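(* Let $M$ be a tropical oriented matroid with parameters $(n,d)$. Then the types of the vertices of $M$ describe a subdivision of $\Delta_{n-1}\times\Delta_{d-1}$; that is, the polytopes $$P_A=\operatorname{conv}\{(e_i,f_j) : 1\le i\le n,\ j\in A_i\},$$ where $A=(A_1,\ldots,A_n)$ ranges over the vertices of $M$, are the full-dimensional cells of a polyhedral subdivision of $\Delta_{n-1}\times\Delta_{d-1}$.
   Context: Write $[d]=\{1,\ldots,d\}$. An $(n,d)$-type is an $n$-tuple $(A_1,\ldots,A_n)$ of nonempty subsets of $[d]$. Comparability graph: given two $(n,d)$-types $A$ and $B$, the comparability graph $CG_{A,B}$ has vertex set $[d]$; for each $1\le i\le n$, and each $j\in A_i$, $k\in B_i$, draw an edge between $j$ and $k$, which is undirected if $j,k\in A_i\cap B_i$ and directed $j\to k$ otherwise (multiple edges are allowed). A directed path from $a$ to $b$ in such a graph with directed and undirected edges is a sequence of vertices $w_0=a,w_1,\ldots,w_k=b$ and edges $e_1,\ldots,e_k$, at least one of which is directed, such that each $e_i$ is either a directed edge from $w_{i-1}$ to $w_i$ or an undirected edge joining them. A directed cycle is a directed path with identical endpoints; the graph is acyclic if it has no directed cycle. Refinement: the refinement of an $(n,d)$-type $A=(A_1,\ldots,A_n)$ with respect to an ordered partition $(P_1,\ldots,P_r)$ of $[d]$ is $B=(A_1\cap P_{m(1)},\ldots,A_n\cap P_{m(n)})$, where $m(i)$ is the largest index for which $A_i\cap P_{m(i)}$ is nonempty. A tropical oriented matroid $M$ with parameters $(n,d)$ is a collection of $(n,d)$-types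 satisfying: (Boundary) for each $j\in[d]$, the type $(j,j,\ldots,j)$ (every coordinate equal to the singleton $\{j\}$) is in $M$; (Elimination) for any $A,B\in M$ and any position $j\in[n]$ there is $C\in M$ with $C_j=A_j\cup B_j$ and $C_k\in\{A_k,B_k,A_k\cup B_k\}$ for all $k\in[n]$; (Comparability) for any $A,B\in M$ the comparability graph $CG_{A,B}$ is acyclic; (Surrounding) if $A\in M$, then every refinement of $A$ is in $M$. For a type $A$, let $G_A$ be the undirected graph with vertex set $[d]$ in which $i$ and $j$ are joined if there is a coordinate $A_k$ with $i,j\in A_k$. A vertex of $M$ is a type $A\in M$ such that $G_A$ is connected. $\Delta_{n-1}=\operatorname{conv}(e_1,\ldots,e_n)\subset\mathbb{R}^n$ and $\Delta_{d-1}=\operatorname{conv}(f_1,\ldots,f_d)\subset\mathbb{R}^d$ are standard simplices with the standard basis vectors as vertices; the vertices of $\Delta_{n-1}\times\Delta_{d-1}$ are the points $(e_i,f_j)$, labelled $(i,j)$. A subdivision of $\Delta_{n-1}\times\Delta_{d-1}$ is given by a collection of full-dimensional polytopes (dimension $n+d-2$), each the convex hull of a subset of the vertices of $\Delta_{n-1}\times\Delta_{d-1}$, whose union is $\Delta_{n-1}\times\Delta_{d-1}$ and any two of which intersect in a common (possibly empty) face. *)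

(* Defs.v *)
From HB Require Import structures.
From mathcomp Require Import all_boot all_order all_algebra.

Set Implicit Arguments.
Unset Strict Implicit.
Unset Printing Implicit Defensive.

Import Order.TTheory GRing.Theory Num.Theory.

(** * Types and tropical oriented matroids

    The index sets [{1,..,n}] and [{1,..,d}] are rendered as ['I_n] and
    ['I_d].  A value of [ntuple_sets n d] is an arbitrary [n]-tuple of subsets
    of ['I_d]; the nonemptiness of the coordinates is [is_type]. *)

Definition ntuple_sets (n d : nat) := {ffun 'I_n -> {set 'I_d}}.

Definition is_type n d (A : ntuple_sets n d) : bool :=
  [forall i, A i != set0].

(** The comparability graph is a multigraph: [(i, j, k)] is the edge between
    [j] and [k] contributed by coordinate [i]. *)
Definition cg_edge (n d : nat) : Type := ('I_n * 'I_d * 'I_d)%type.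

Section ComparabilityGraph.
Variables (n d : nat) (A B : ntuple_sets n d).

Definition in_cg (e : cg_edge n d) : bool :=
  let: (i, j, k) := e in (j \in A i) && (k \in B i).

Definition undirected (e : cg_edge n d) : bool :=
  let: (i, j, k) := e in (j \in A i :&: B i) && (k \in A i :&: B i).

(** [e] can be followed from [u] to [w]. *)
Definition traverses (e : cg_edge n d) (u w : 'I_d) : bool :=
  let: (i, j, k) := e in
  ((j == u) && (k == w)) || [&& undirected e, j == w & k == u].

(** [p] lists the pairs (e_1, w_1), ..., (e_k, w_k) of a walk from [w0]. *)
Fixpoint walk (w0 : 'I_d) (p : seq (cg_edge n d * 'I_d)) : bool :=
  if p is (e, w) :: p' then [&& in_cg e, traverses e w0 w & walk w p']
  else true.

Definition directed_path (a b : 'I_d) (p : seq (cg_edge n d * 'I_d)) : bool :=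
  [&& walk a p, last a (unzip2 p) == b & has (predC undirected) (unzip1 p)].

Definition cg_acyclic : Prop := forall a p, ~~ directed_path a a p.

End ComparabilityGraph.

Definition ordered_partition d (P : seq {set 'I_d}) : bool :=
  uniq P && partition [set:: P] [set: 'I_d].

(** [m] is the index m(i) of the definition of a refinement. *)
Definition is_refinement n d (A : ntuple_sets n d) r
    (P : r.-tuple {set 'I_d}) (B : ntuple_sets n d) : Prop :=
  forall i, exists m : 'I_r,
    [/\ A i :&: tnth P m != set0,
        forall m' : 'I_r, m < m' -> A i :&: tnth P m' = set0
      & B i = A i :&: tnth P m].

Record tropical_oriented_matroid n d (M : {set ntuple_sets n d}) : Prop := {
  tom_types : forall A, A \in M -> is_type A;
  tom_boundary : forall j : 'I_d, [ffun=> [set j]] \in M;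
  tom_elimination : forall A B, A \in M -> B \in M -> forall j : 'I_n,
    exists C, [/\ C \in M, C j = A j :|: B j
      & forall k, [\/ C k = A k, C k = B k | C k = A k :|: B k]];
  tom_comparability : forall A B, A \in M -> B \in M -> cg_acyclic A B;
  tom_surrounding : forall A, A \in M ->
    forall r (P : r.-tuple {set 'I_d}) B,
    ordered_partition P -> is_refinement A P B -> B \in M
}.

Definition type_graph n d (A : ntuple_sets n d) : rel 'I_d :=
  fun i j => [exists k, (i \in A k) && (j \in A k)].

Definition is_vertex n d (M : {set ntuple_sets n d}) (A : ntuple_sets n d) : Prop :=
  A \in M /\ forall i j, connect (type_graph A) i j.

(** * Polytopes and subdivisions *)

From mathcomp Require Import boolp classical_sets reals convex.

Local Open Scope classical_set_scope.
Local Open Scope ring_scope.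

Section Polytopes.
Variables (R : realType) (m : nat).
Local Notation E := 'rV[R]_m.
Implicit Types (P F S : set E).

Definition conv_hull S : set E := smallest (@convex_set R E) S.

Definition affine_through (x0 : E) (U : {vspace E}) : set E :=
  [set x | x - x0 \in U].

Definition affine_subspace S : Prop := exists x0 U, S = affine_through x0 U.

Definition affine_hull S : set E := smallest affine_subspace S.

Definition has_dim S (k : nat) : Prop :=
  exists x0 U, affine_hull S = affine_through x0 U /\ \dim U = k.

(** Faces are cut out by valid linear inequalities; [a = 0] yields [P] itself
    (with [b = 0]) and the empty face (with [b = 1]). *)
Definition is_face F P : Prop :=
  exists (a : 'cV[R]_m) (b : R),
    (forall x, P x -> (x *m a) 0 0 <= b) /\
    F = P `&` [set x | (x *m a) 0 0 = b].

End Polytopes.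

Definition std_simplex (R : realType) (k : nat) : set 'rV[R]_k :=
  conv_hull [set delta_mx 0 i | i in [set: 'I_k]].

Arguments std_simplex : clear implicits.

Section ProductOfSimplices.
Variables (R : realType) (n d : nat).

(** [R^n x R^d] is identified with [R^(n+d)] by concatenation. *)
Definition simplex_product : set 'rV[R]_(n + d) :=
  [set row_mx x y | x in std_simplex R n & y in std_simplex R d].

(** The point [(e_i, f_j)]. *)
Definition prod_vertex (i : 'I_n) (j : 'I_d) : 'rV[R]_(n + d) :=
  row_mx (delta_mx 0 i) (delta_mx 0 j).

Definition prod_vertices : set 'rV[R]_(n + d) :=
  [set prod_vertex i j | i in [set: 'I_n] & j in [set: 'I_d]].

(** [C] is the collection of full-dimensional cells. *)
Definition is_subdivision (C : set (set 'rV[R]_(n + d))) : Prop :=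
  [/\ forall P, C P ->
        (exists2 V, V `<=` prod_vertices & P = conv_hull V) /\
        has_dim P (n + d - 2),
      \bigcup_(P in C) P = simplex_product
    & forall P Q, C P -> C Q -> is_face (P `&` Q) P /\ is_face (P `&` Q) Q].

Definition cell (A : ntuple_sets n d) : set 'rV[R]_(n + d) :=
  conv_hull [set x | exists i j, j \in A i /\ x = prod_vertex i j].

End ProductOfSimplices.

Arguments simplex_product : clear implicits.
Arguments prod_vertices : clear implicits.
Arguments cell R {n d} A.

(* Main.v *)
Require Import Defs.
From HB Require Import structures.
From mathcomp Require Import all_boot all_order all_algebra.
From mathcomp Require Import zify ring lra.

(** A point of the product of simplices is a pair [(x, y)] of probability vectors,
    and it lies in the cell of a type [A] exactly when some nonnegative matrix
    supported on the pairs [(i, j)] with [j \in A i] has row sums [x] and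
    column sums [y], a transport for short.

    Cells meet in common faces because of comparability alone.  An acyclic
    comparability graph carries a potential ([acyclic_potential]), from which one
    reads off a linear function that is nonpositive on one cell, nonnegative
    on the other and zero exactly on the generators they share
    ([acyclic_separation], [cell_face]).  Cells of vertices have full dimension because
    connectivity of the type graph lets the differences of generators span all
    directions ([affine_hull_cell]).

    The substance is that the cells cover the product.  Think of a type as
    recording, at a price vector of [d] goods, which goods each of [n] buyers
    accepts, of [x i] as the budget of buyer [i] and of [y j] as the supply of
    good [j].  A point is covered when the market clears, and by Gale's theorem
    ([gale]) this happens when no set of goods is forced to receive more money
    than its supply.  If there is such an overdemanded set, a smallest one of
    largest excess has its prices raised until some buyer confined to it
    accepts a new good; uncrossing of excesses ([excess_uncross]) shows that
    this makes progress, so a type that is optimal in the appropriate sense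
    clears the market ([tom_covers]).

    The oriented matroid axioms have to justify the step of raising prices until
    something new happens ([merge]).  Elimination allows to travel from a
    type [F] towards a type [T], and refinements allow to back up when one went
    too far ([merge_step]); but the target [T] has to describe the limit where the
    raised prices are infinite and the rows of [F] not concerned are
    unchanged.  Such a type exists ([face_extension]) if the types using only the
    remaining goods [W] already cover the corresponding face: a generic
    point of the cell of the unconcerned rows lies in the cell of such a type, and
    comparability shows that a refinement of it agrees with [F] there.  As [W] has
    fewer goods, the covering statement is proved by induction on their
    number.  The same merging step finally enlarges any type to a vertex
    ([extend_to_vertex]). *)

Set Implicit Arguments.
Unset Strict Implicit.
Unset Printing Implicit Defensive.

Import Order.TTheory GRing.Theory Num.Theory.

(** * Potentials on comparability graphs *)

Section Potentials.
Variables (n d : nat) (A B : ntuple_sets n d).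

Let step : rel 'I_d :=
  fun u w => [exists e : 'I_n * 'I_d * 'I_d, in_cg A B e && traverses A B e u w].

Lemma step_walk u p : path step u p ->
  exists q, walk A B u q /\ last u (unzip2 q) = last u p.
Proof.
elim: p u => [|w p IHp] u /=; first by exists [::].
case/andP=> /existsP[e /andP[e_cg e_uw]] /IHp[q [q_walk q_last]].
by exists ((e, w) :: q); rewrite /= e_cg e_uw q_walk.
Qed.

(** The potential of a vertex counts the vertices from which it can be reached.
    Following an edge can only enlarge that set; it enlarges it strictly along a
    directed edge, since otherwise the edge could be closed up to a directed
    cycle.  For the types of two tropical points, the difference of the points is,
    up to sign, such a potential. *)
Lemma acyclic_potential : cg_acyclic A B ->
  exists h : 'I_d -> nat, forall i j k, j \in A i -> k \in B i ->
    h j <= h k ?= iff (j \in B i) && (k \in A i).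
Proof.
move=> acyc; exists (fun u => #|[set v | connect step v u]|) => i j k jA kB.
have jk : step j k.
  by apply/existsP; exists (i, j, k); rewrite /= jA kB !eqxx.
have sub_jk : [set v | connect step v j] \subset [set v | connect step v k].
  apply/subsetP=> v; rewrite !inE => vj.
  exact: connect_trans vj (connect1 jk).
split; first exact: subset_leq_card.
rewrite eqn_leq subset_leq_card //=; apply/idP/idP => [le_kj | /andP[jB kA]].
- have kj : connect step k j.
    have eq_card := anti_leq (introT andP (conj (subset_leq_card sub_jk) le_kj)).
    by have := subset_cardP eq_card sub_jk k; rewrite !inE connect0.
  case/connectP: kj => p /step_walk[q [q_walk q_last]] lastp.
  (* a directed edge from j to k and a walk back make a directed cycle *)
  apply/negPn/negP=> dir.
  have /negP[] := acyc j (((i, j, k), k) :: q).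
  rewrite /directed_path /= jA kB !eqxx q_walk q_last lastp eqxx /=.
  by rewrite -lastp !inE jA kB andbT dir.
- apply: subset_leq_card; apply/subsetP=> v; rewrite !inE => vk.
  apply: connect_trans vk (connect1 _).
  apply/existsP; exists (i, j, k).
  by rewrite /= jA kB !inE jA jB kA kB !eqxx orbT.
Qed.

(** The function sending [(e_i, f_j)] to [h j - t i] is nonpositive on the cell
    of [A], nonnegative on the cell of [B], and vanishes at a generator of either
    exactly when both types contain it. *)
Definition separates (h : 'I_d -> nat) (t : 'I_n -> nat) : Prop :=
  forall i j, (j \in A i -> h j <= t i ?= iff (j \in B i)) /\
    (j \in B i -> t i <= h j ?= iff (j \in A i)).

(** Row by row, the potential puts [A i] below [B i].  If the two sets meet, the
    potential is constant on their intersection and [t i] is forced to be that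
    value; otherwise there is a gap, in which [t i] is chosen. *)
Lemma acyclic_separation : cg_acyclic A B ->
  exists h t, separates h t.
Proof.
(* doubling the potential makes room for an integer strictly inside each gap,
   and adding 1 keeps the empty maximum below all values *)
case/acyclic_potential=> h hP; pose h' j := (h j).*2.+1.
have h'P i j k : j \in A i -> k \in B i ->
    h' j <= h' k ?= iff (j \in B i) && (k \in A i).
  move=> jA kB; have [le_h eq_h] := hP i j k jA kB.
  by split; rewrite ?eqSS ?ltnS ?leq_double // -eq_h; lia.
exists h', (fun i => if [pick c in A i :&: B i] is Some c then h' c
                     else \max_(j in A i) (h' j).+1) => i j.
case: pickP => [c|noc].
  rewrite inE => /andP[cA cB]; split=> [jA|jB].
    by have := h'P _ _ _ jA cB; rewrite cA andbT.
  by have := h'P _ _ _ cA jB; rewrite cB.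
split=> [jA|jB].
  have jB : (j \in B i) = false by have := noc j; rewrite inE jA.
  have lt_j : h' j < \max_(j in A i) (h' j).+1.
    exact: (@leq_bigmax_cond _ (mem (A i)) (fun k => (h' k).+1) j jA).
  by split; [exact: ltnW | rewrite jB ltn_eqF].
have jA : (j \in A i) = false by have := noc j; rewrite inE jB andbT.
have lt_j : \max_(j in A i) (h' j).+1 < h' j.
  rewrite ltnS; apply/bigmax_leqP=> k kA.
  have [le_h eq_h] := hP i k j kA jB; rewrite jA andbF in eq_h.
  rewrite /h'; lia.
by split; [exact: ltnW | rewrite jA ltn_eqF].
Qed.

End Potentials.

(** * Refinements by level sets *)

Section Refine.
Variables (n d : nat) (M : {set ntuple_sets n d}).
Hypothesis tomM : tropical_oriented_matroid M.

(** The refinement with respect to the ordered partition into the level sets of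
    [g], in increasing order. *)
Definition refine_by (g : 'I_d -> nat) (A : ntuple_sets n d) : ntuple_sets n d :=
  [ffun i => [set k in A i | [forall k' in A i, g k' <= g k]]].

Lemma in_refine_by g (A : ntuple_sets n d) i k :
  reflect (k \in A i /\ forall k', k' \in A i -> g k' <= g k) (k \in refine_by g A i).
Proof.
rewrite ffunE inE; apply: (iffP andP) => [[kA /forall_inP le_k]|[kA le_k]] //.
by split=> //; apply/forall_inP.
Qed.

Lemma type_mem (A : ntuple_sets n d) i : A \in M -> exists j, j \in A i.
Proof. by move/(tom_types tomM)/forallP/(_ i)/set0Pn. Qed.

(** The definition of a refinement asks for an explicit ordered partition into
    nonempty blocks: here it is indexed by the sorted list of the values of
    [g]. *)
Lemma refine_by_tom g (A : ntuple_sets n d) : A \in M -> refine_by g A \in M.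
Proof.
move=> AM; pose s := sort leq (undup (codom g)).
pose P := [seq [set k | g k == v] | v <- s].
have s_uniq : uniq s by rewrite sort_uniq undup_uniq.
have mem_s v : (v \in s) = (v \in codom g) by rewrite mem_sort mem_undup.
have s_sorted : sorted ltn s.
  by rewrite ltn_sorted_uniq_leq s_uniq sort_sorted //; exact: leq_total.
have size_P : size P = size s by rewrite size_map.
apply: (@tom_surrounding _ _ _ tomM A AM (size P) (in_tuple P)) => [|i].
  apply/andP; split.
    rewrite map_inj_in_uniq // => u v; rewrite !mem_s => /codomP[k ->] _.
    by move/setP/(_ k); rewrite !inE eqxx => /esym/eqP.
  suff -> : [set:: in_tuple P] = preim_partition g [set: 'I_d].
    exact: preim_partitionP.
  apply/setP=> X; rewrite inE; apply/mapP/imsetP => [[v] | [k _ ->]].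
    rewrite mem_s => /codomP[k ->] ->; exists k => //.
    by apply/setP=> k'; rewrite !inE eq_sym.
  exists (g k); first by rewrite mem_s codom_f.
  by apply/setP=> k'; rewrite !inE eq_sym.
have [k0 k0A] := type_mem i AM.
case: (@arg_maxnP _ k0 (mem (A i)) g k0A) => k kA max_k.
have gk_s : g k \in s by rewrite mem_s codom_f.
have lt_m : index (g k) s < size P by rewrite size_P index_mem.
have tnthE (m : 'I_(size P)) : tnth (in_tuple P) m = [set k' | g k' == nth 0 s m].
  by rewrite (tnth_nth set0) /= (nth_map 0) // -size_P.
exists (Ordinal lt_m); rewrite tnthE /= nth_index //; split.
- by apply/set0Pn; exists k; rewrite !inE eqxx andbT.
- move=> m' lt_mm'; rewrite tnthE; apply/setP=> k'; rewrite !inE.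
  apply/negP=> /andP[/max_k /= le_k' /eqP gk'].
  have : nth 0 s (index (g k) s) < nth 0 s m'.
    by apply: (sorted_ltn_nth ltn_trans) => //; rewrite inE -?size_P ?lt_m.
  by rewrite nth_index // -gk' ltnNge le_k'.
- apply/setP=> k'; apply/in_refine_by/idP => [[k'A le_k']|].
    by rewrite !inE k'A eqn_leq (le_k' k kA) andbT; exact: max_k.
  by rewrite !inE => /andP[k'A /eqP ->]; split=> // k'' /max_k.
Qed.

Lemma refine_by_id (g : 'I_d -> nat) (A : ntuple_sets n d) i :
  (forall j k, j \in A i -> k \in A i -> g j = g k) -> refine_by g A i = A i.
Proof.
move=> g_const; apply/setP=> k; apply/in_refine_by/idP => [[]//|kA].
by split=> // j jA; rewrite (g_const j k).
Qed.

End Refine.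

(** * Transports and Gale's theorem *)

Section Transport.
Variables (R : realFieldType) (n d : nat).
Implicit Types (x : 'I_n -> R) (y : 'I_d -> R) (A C : ntuple_sets n d).
Local Open Scope ring_scope.

(** The transports of [A] with marginals [x] and [y] are the ways of writing
    [(x, y)] as a nonnegative combination of the generators of the cell of
    [A]. *)
Definition transport A x y (m : 'I_n -> 'I_d -> R) : Prop :=
  [/\ forall i j, 0 <= m i j,
      forall i j, j \notin A i -> m i j = 0,
      forall i, \sum_j m i j = x i
    & forall j, \sum_i m i j = y j].

(** In the market where buyer [i] spends [x i] on goods of [A i] only, and [y j]
    is the supply of good [j], this is the forced demand for the goods of [S]
    minus their supply. *)
Definition excess x y A (S : {set 'I_d}) : R :=
  \sum_(i | A i \subset S) x i - \sum_(j in S) y j.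

(** The type [C] is to be thought of as [A] after the prices of the goods of [S]
    were raised: buyers with a choice outside [S] may have given up [S], while
    the others may have gained new choices.  If [C i] lies inside [T], then [A i]
    lies inside [T :&: S] or at least inside [T :|: S], according to whether it lies
    inside [S]; so the inequality holds buyer by buyer.  When [S] maximizes the
    excess for [A], it says that raising its prices does not increase the
    largest excess, and it describes the sets for which that value persists. *)
Lemma excess_uncross x y A C (S T : {set 'I_d}) : (forall i, 0 <= x i) ->
    (forall i, A i \subset S -> A i \subset C i) ->
    (forall i, A i :\: S \subset C i) ->
  excess x y C T + excess x y A S
    <= excess x y A (T :&: S) + excess x y A (T :|: S).
Proof.
move=> x_ge0 subS subD; rewrite /excess.
have y_mod : \sum_(j in T) y j + \sum_(j in S) y j
    = \sum_(j in T :&: S) y j + \sum_(j in T :|: S) y j.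
  rewrite ![\sum_(j in _) y j]big_mkcond -!big_split /=; apply: eq_bigr => j _.
  by rewrite !inE; case: (j \in T); case: (j \in S); rewrite /= ?addr0 ?add0r.
suff x_mod : \sum_(i | C i \subset T) x i + \sum_(i | A i \subset S) x i
    <= \sum_(i | A i \subset T :&: S) x i + \sum_(i | A i \subset T :|: S) x i.
  by lra.
rewrite ![\sum_(i | _) x i]big_mkcond -!big_split /=; apply: ler_sum => i _.
have x_i := x_ge0 i; rewrite subsetI.
have [AS|nAS] := boolP (A i \subset S); rewrite ?andbT ?andbF /=.
  rewrite (subset_trans AS (subsetUr _ _)).
  have [CT|_] := boolP (C i \subset T); last by case: ifP => _; lra.
  by rewrite (subset_trans (subS i AS) CT).
have [CT|_] := boolP (C i \subset T); last by case: ifP => _; lra.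
by rewrite setUC -subDset (subset_trans (subD i) CT) addr0 add0r.
Qed.

Lemma sum_delta (I : finType) (P : pred I) (i : I) (t : R) :
  \sum_(l | P l) t *+ (l == i) = t *+ P i.
Proof.
rewrite big_mkcond (bigD1 i) //= eqxx big1 ?addr0 => [|l /negPf->].
  by case: (P i).
by rewrite if_same.
Qed.

Lemma excess_push x y A i j t (S : {set 'I_d}) :
  excess (fun l => x l - t *+ (l == i)) (fun k => y k - t *+ (k == j)) A S
  = excess x y A S - t *+ (A i \subset S) + t *+ (j \in S).
Proof. by rewrite /excess !sumrB !sum_delta; ring. Qed.

(** Gale's theorem: a transport exists as soon as no set of goods has positive
    excess.  Send as much as possible along one edge [(i, j)].  This either
    exhausts buyer [i], or makes the excess of some set [S] containing [j], but
    not all of [A i], equal to 0.  In the second case, removing [S] from all the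
    [A l] not contained in it creates no positive excess, by uncrossing, and
    deletes at least the edge [(i, j)]. *)
Lemma gale A x y : (forall i, 0 <= x i) -> (forall j, 0 <= y j) ->
    \sum_i x i = \sum_j y j -> (forall S, excess x y A S <= 0) ->
  exists m, transport A x y m.
Proof.
have [N] := ubnP (\sum_i #|A i| + #|[set i | x i != 0%R]|)%N.
elim: N A x y => // N IHN A x y le_N x_ge0 y_ge0 eq_xy hall.
have [i xi_neq0|x0] := pickP (fun i => x i != 0); last first.
  have {}x0 i : x i = 0 by move/(_ i)/eqP: x0.
  have sum_y : \sum_j y j = 0 by rewrite -eq_xy big1.
  have y0 j : y j = 0.
    move/eqP: sum_y; rewrite psumr_eq0 => [/allP y0|k _]; last exact: y_ge0.
    exact/eqP/(y0 j (mem_index_enum j)).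
  by exists (fun _ _ => 0); split=> // [i|j]; rewrite big1.
have xi_gt0 : 0 < x i by rewrite lt_def xi_neq0 x_ge0.
have le_excess (S : {set 'I_d}) : A i \subset S ->
    x i <= excess x y A S + \sum_(k in S) y k.
  move=> AS; rewrite subrK (bigD1 i) //= lerDl sumr_ge0 // => l _; exact: x_ge0.
have [j jA] : exists j, j \in A i.
  apply/set0Pn; apply/negP=> /eqP Ai0.
  have := le_excess set0; rewrite Ai0 sub0set big_set0 addr0 => /(_ isT).
  by have := hall set0; lra.
pose open (S : {set 'I_d}) := (j \in S) && ~~ (A i \subset S).
(* t is the largest amount that can be sent along the edge *)
have [t [t_ge0 le_t le_tS t_max]] : exists t, [/\ 0 <= t, t <= x i,
    forall S, open S -> t <= - excess x y A S
    & t = x i \/ exists2 S, open S & t = - excess x y A S].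
  have [S0 openS0|noS] := pickP open; last first.
    by exists (x i); split; [exact: x_ge0 | | move=> S; rewrite noS | left].
  case: (arg_minP (fun S => - excess x y A S) openS0) => S openS minS.
  have [le_x|lt_x] := lerP (x i) (- excess x y A S).
    exists (x i); split=> //; last by left.
    by move=> S' /minS; apply: le_trans.
  exists (- excess x y A S); split; [by rewrite oppr_ge0 hall | exact: ltW | by [] |].
  by right; exists S.
pose x' l := x l - t *+ (l == i); pose y' k := y k - t *+ (k == j).
have x'_ge0 l : 0 <= x' l.
  by rewrite /x'; case: eqP => [->|_]; rewrite ?subr0 ?subr_ge0.
have y'_ge0 k : 0 <= y' k.
  rewrite /y'; case: eqP => [->|_]; rewrite ?subr0 ?mulr1n ?subr_ge0 //.
  have [AS|nAS] := boolP (A i \subset [set j]).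
    have := le_excess _ AS; rewrite big_set1.
    by have := hall [set j]; lra.
  have := le_tS [set j]; rewrite /open set11 nAS => /(_ isT).
  rewrite /excess big_set1 opprB; have : 0 <= \sum_(l | A l \subset [set j]) x l.
    exact: sumr_ge0.
  lra.
have eq_xy' : \sum_l x' l = \sum_k y' k.
  by rewrite !sumrB !sum_delta eq_xy.
have hall' S : excess x' y' A S <= 0.
  rewrite excess_push; have := hall S; have := le_tS S; rewrite /open.
  have [AS|nAS] := boolP (A i \subset S).
    by rewrite (subsetP AS _ jA) subrK.
  by case: (j \in S) => /=; [move=> /(_ isT); lra | lra].
have push_back (A' : ntuple_sets n d) : (forall l, A' l \subset A l) ->
    (exists m, transport A' x' y' m) -> exists m, transport A x y m.
  move=> subA [m [m_ge0 m_supp m_row m_col]].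
  exists (fun l k => m l k + t *+ ((l == i) && (k == j))); split.
  - by move=> l k; rewrite addr_ge0 ?mulrn_wge0.
  - move=> l k nkA; rewrite m_supp; last by apply: contra nkA; apply: subsetP.
    rewrite add0r; case: eqP => //= l_i; case: eqP => // k_j.
    by rewrite l_i k_j jA in nkA.
  - move=> l; rewrite big_split /= m_row /x'; case: (l == i) => /=.
      by rewrite sum_delta subrK.
    by rewrite subr0 big1 ?addr0.
  - move=> k; rewrite big_split /= m_col /y'; case: (k == j) => /=.
      by under [X in _ + X]eq_bigr do rewrite andbT; rewrite sum_delta subrK.
    by rewrite subr0 big1 ?addr0 // => l _; rewrite andbF.
have supp_x' : [set l | x' l != 0] \subset [set l | x l != 0].
  apply/subsetP=> l; rewrite !inE /x'.
  by case: (l =P i) => [-> //|_]; rewrite subr0.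
have leq_supp := subset_leq_card supp_x'.
case: t_max => [t_x|[S openS t_S]].
  apply: (push_back A) => //; apply: (IHN A) => //.
  rewrite ltnS in le_N; apply: leq_trans le_N; rewrite ltn_add2l.
  apply: proper_card; rewrite properE supp_x'; apply/subsetPn; exists i.
    by rewrite inE.
  by rewrite inE /x' eqxx t_x subrr eqxx.
have [jS nAS] := andP openS.
pose A' : ntuple_sets n d := [ffun l => if A l \subset S then A l else A l :\: S].
have subA' l : A' l \subset A l.
  by rewrite ffunE; case: ifP => // _; exact: subsetDl.
apply: (push_back A') => //; apply: (IHN A') => //.
  rewrite ltnS in le_N; apply: leq_trans le_N; rewrite -addSn leq_add //.
  rewrite (bigD1 i) //= [X in (_ < X)%N](bigD1 i) //= -addSn leq_add //.
    rewrite ffunE (negPf nAS) proper_card // properE subsetDl /=.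
    by apply/subsetPn; exists j; rewrite // !inE jS.
  by apply: leq_sum => l _; apply: subset_leq_card.
move=> T; have := @excess_uncross x' y' A A' S T x'_ge0.
have -> : excess x' y' A S = 0.
  by rewrite excess_push (negPf nAS) jS mulr0n mulr1n subr0 t_S addrN.
move=> uncross; have := hall' (T :&: S); have := hall' (T :|: S).
suff /uncross : forall l, A l \subset S -> A l \subset A' l.
  have subD l : A l :\: S \subset A' l.
    by rewrite ffunE; case: ifP => // _; exact: subsetDl.
  by move=> /(_ subD); lra.
by move=> l AS; rewrite ffunE AS.
Qed.

End Transport.

(** * Covering by types *)

Section Covering.
Variables (R : realFieldType) (n d : nat).
Implicit Types (x : 'I_n -> R) (y : 'I_d -> R) (W S : {set 'I_d}).
Implicit Types (A B C D F T : ntuple_sets n d).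
Local Open Scope ring_scope.

Lemma transport_price A x y m (u : 'I_d -> R) (v : 'I_n -> R) :
    transport A x y m ->
  \sum_i \sum_j m i j * u j = \sum_j y j * u j /\
  \sum_i \sum_j m i j * v i = \sum_i x i * v i.
Proof.
case=> _ _ m_row m_col; split.
  by rewrite exchange_big /=; apply: eq_bigr => j _; rewrite -mulr_suml m_col.
by apply: eq_bigr => i _; rewrite -mulr_suml m_row.
Qed.

Lemma separated_le A B h t x y m : separates A B h t -> transport A x y m ->
  \sum_j y j * (h j)%:R <= \sum_i x i * (t i)%:R
    ?= iff [forall i, forall j, (m i j != 0) ==> (j \in B i)].
Proof.
move=> sep mA; have [m_ge0 m_supp _ _] := mA.
have [<- <-] := transport_price (fun j => (h j)%:R) (fun i => (t i)%:R) mA.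
apply: leif_sum => i _; apply: leif_sum => j _.
have [->|mij] := eqVneq (m i j) 0; first by rewrite !mul0r; split; rewrite ?lexx ?eqxx.
have jA : j \in A i by apply: contraNT mij => /m_supp ->.
have [le_ht eq_ht] := (sep i j).1 jA; split; first by rewrite ler_wpM2l ?ler_nat.
by rewrite (inj_eq (mulfI mij)) eqr_nat eq_ht.
Qed.

Lemma separated_ge A B h t x y m : separates A B h t -> transport B x y m ->
  \sum_i x i * (t i)%:R <= \sum_j y j * (h j)%:R.
Proof.
move=> sep mB; have [m_ge0 m_supp _ _] := mB.
have [<- <-] := transport_price (fun j => (h j)%:R) (fun i => (t i)%:R) mB.
apply: ler_sum => i _; apply: ler_sum => j _.
have [jB|/m_supp ->] := boolP (j \in B i); last by rewrite !mul0r.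
by rewrite ler_wpM2l // ler_nat; exact: ((sep i j).2 jB).1.
Qed.

(** Two transports with the same marginals have the same total value of
    [h j - t i]; being nonpositive for one type and nonnegative for the other, it
    is 0, so the transports only use common edges. *)
Lemma transport_common A B x y m m' : cg_acyclic A B ->
    transport A x y m -> transport B x y m' ->
  forall i j, m i j != 0 -> j \in B i.
Proof.
case/acyclic_separation=> h [t sep] mA m'B i j.
have := separated_ge sep m'B; rewrite (ge_leif (separated_le sep mA)).
by move/forallP/(_ i)/forallP/(_ j)/implyP.
Qed.

Variable M : {set ntuple_sets n d}.
Hypothesis tomM : tropical_oriented_matroid M.

(** The cells of the types that only use the goods of [W] cover the face of the
    product of simplices spanned by [W].  The marginals are not normalized: the
    total mass is arbitrary. *)
Definition covers (W : {set 'I_d}) : Prop :=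
  forall x y, (forall i, 0 <= x i) -> (forall j, 0 <= y j) ->
    \sum_i x i = \sum_j y j -> (forall j, j \notin W -> y j = 0) ->
  exists A, [/\ A \in M, forall i, A i \subset W & exists m, transport A x y m].

(** For a tropical point this sends all the prices outside [W] to infinity while
    keeping the prices inside.  The covering of the face produces a type [B]
    inside [W] whose cell contains a point in the relative interior of the face
    of the cell of [F] spanned by the rows contained in [W].  In these rows [B]
    then contains [F], and comparability makes [F] the refinement of [B] by the
    potential leading from [B] to [F]. *)
Lemma face_extension W F : covers W -> F \in M ->
  exists T, [/\ T \in M, forall i, T i \subset W
    & forall i, F i \subset W -> T i = F i].
Proof.
move=> covW FM.
(* mass 1 on every edge in the rows of F inside W *)
pose m i j : R := ((F i \subset W) && (j \in F i))%:R.
pose x i := \sum_j m i j; pose y j := \sum_i m i j.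
have m_ge0 i j : 0 <= m i j by rewrite /m; case: andP.
have mF : transport F x y m.
  by split=> // i j /negPf njF; rewrite /m njF andbF.
have [|||j njW|B [BM BW [m' m'B]]] := covW x y.
- by move=> i; apply: sumr_ge0.
- by move=> j; apply: sumr_ge0.
- exact: exchange_big.
- apply: big1 => i _; rewrite /m; case: andP => // -[FW jF].
  by rewrite (subsetP FW _ jF) in njW.
have subFB i : F i \subset W -> F i \subset B i.
  move=> FW; apply/subsetP=> j jF.
  apply: (transport_common (tom_comparability tomM FM BM) mF m'B).
  by rewrite /m FW jF oner_neq0.
have [h hP] := acyclic_potential (tom_comparability tomM BM FM).
exists (refine_by h B); split; first exact: refine_by_tom.
  by move=> i; apply: subset_trans (BW i); apply/subsetP=> k /in_refine_by[].
move=> i FW; have FB := subsetP (subFB i FW).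
apply/setP=> k; apply/in_refine_by/idP => [[kB max_k]|kF].
  have [j jF] := type_mem tomM i FM.
  have [le_kj eq_kj] := hP i k j kB jF.
  have := eq_kj; rewrite eqn_leq le_kj (max_k j (FB j jF)) /=.
  by case/esym/andP.
by split=> [|j jB]; [exact: FB | have [] := hP i j k jB kF].
Qed.

(** On the tropical segment from [F] to a point [T] where the prices outside [W]
    are infinite, stop when a row outside [W] first acquires goods of [W]: it
    acquires those of [T].  Combinatorially, eliminate [F] with some type [D]
    whose rows all agree with [F] or with [T], starting from [T], at a row outside
    [W] where [D] agrees with [T].  If other rows have already switched
    completely to [T], the result is too far; then lower the prices
    outside [W] slightly, by a refinement, to get a new [D] with fewer rows
    agreeing with [T], and repeat. *)
Lemma merge_step W F T :
    F \in M -> (forall i, ~~ (F i \subset W) -> [disjoint F i & W]) ->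
    T \in M -> (forall i, T i \subset W) -> (forall i, F i \subset W -> T i = F i) ->
    (exists i, ~~ (F i \subset W)) ->
  exists C, [/\ C \in M,
    forall i, C i = F i \/ ~~ (F i \subset W) /\ C i = F i :|: T i
    & exists i, ~~ (F i \subset W) /\ C i = F i :|: T i].
Proof.
move=> FM FdW TM TW TF [i0 nF0W].
pose bad D := [set i | ~~ (F i \subset W) && (D i == T i)].
suff step N D : (#|bad D| < N)%N -> D \in M -> (forall i, D i = F i \/ D i = T i) ->
    bad D != set0 -> exists C, [/\ C \in M,
    forall i, C i = F i \/ ~~ (F i \subset W) /\ C i = F i :|: T i
    & exists i, ~~ (F i \subset W) /\ C i = F i :|: T i].
  apply: (step _ T (ltnSn _)) => // [i|]; first by right.
  by apply/set0Pn; exists i0; rewrite inE nF0W eqxx.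
elim: N D => // N IHN D lt_N DM D_FT /set0Pn[i]; rewrite inE => /andP[nFiW /eqP Di].
have [C [CM Ci C_FD]] := tom_elimination tomM FM DM i.
rewrite Di in Ci.
have C_onW k : F k \subset W -> C k = F k.
  move=> FW; have Dk : D k = F k by case: (D_FT k) => //; rewrite (TF k FW).
  by case: (C_FD k) => ->; rewrite ?Dk ?setUid.
have C_offW k : ~~ (F k \subset W) ->
    [\/ C k = F k, C k = T k /\ D k = T k | C k = F k :|: T k].
  move=> nFW; case: (D_FT k) => Dk; case: (C_FD k) => ->; rewrite Dk ?setUid;
    try by apply: Or31.
    by apply: Or32.
  exact: Or33.
have [bad0|bad_neq0] := eqVneq (bad C) set0.
  exists C; split=> // [k|]; last by exists i.
  have [FW|nFW] := boolP (F k \subset W); first by left; exact: C_onW.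
  case: (C_offW k nFW) => [|[Ck _]|]; [by left | | by right].
  by have /setP/(_ k) := bad0; rewrite !inE nFW Ck eqxx.
(* lowering the prices outside W undoes all partial switches *)
pose D' := refine_by (fun k => k \notin W) C.
have D'E k : D' k = if k \in bad C then T k else F k.
  have [FW|nFW] := boolP (F k \subset W).
    rewrite inE FW /= -(C_onW k FW); apply: refine_by_id => j j'.
    by rewrite C_onW // => /(subsetP FW) -> /(subsetP FW) ->.
  have FnW j : j \in F k -> j \notin W.
    by move=> jF; apply: contraTN (FdW k nFW) => jW; apply/pred0Pn; exists j; apply/andP.
  have [j jF] := type_mem tomM k FM.
  have neqT : (F k == T k) = false by apply/eqP=> FT; rewrite FT TW in nFW.
  have neqTU : (F k :|: T k == T k) = false.
    apply/eqP=> /setP/(_ j); rewrite inE jF => /esym/(subsetP (TW k)).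
    by rewrite (negPf (FnW j jF)).
  rewrite inE nFW /=; case: (C_offW k nFW) => [|[]|] Ck; rewrite Ck ?eqxx ?neqT ?neqTU.
  - rewrite -Ck; apply: refine_by_id => a b; rewrite Ck => /FnW -> /FnW ->; by [].
  - move=> _; rewrite -Ck; apply: refine_by_id => a b.
    by rewrite Ck => /(subsetP (TW k)) -> /(subsetP (TW k)) ->.
  - apply/setP=> a; apply/in_refine_by/idP; rewrite Ck inE.
      case=> /orP[//|/(subsetP (TW k)) aW] /(_ j); rewrite inE jF aW FnW //.
      by move=> /(_ isT).
    by move=> aF; rewrite aF FnW //; split=> // b _; case: (b \in W).
have badD' : bad D' = bad C.
  apply/setP=> k; rewrite [LHS]inE D'E; case: ifP => [|_].
    by rewrite inE eqxx andbT => /andP[].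
  by apply/negP=> /andP[nFW /eqP FT]; rewrite FT TW in nFW.
apply: (IHN D'); last by rewrite badD'.
- rewrite ltnS in lt_N; apply: leq_trans lt_N; rewrite badD'; apply: proper_card.
  rewrite properE; apply/andP; split.
    apply/subsetP=> k; rewrite !inE => /andP[nFW /eqP Ck]; rewrite nFW /=.
    case: (C_offW k nFW) => [|[_ ->]|] //; rewrite Ck => FT.
      by rewrite -FT TW in nFW.
    by have := TW k; rewrite FT subUset (negPf nFW).
  apply/subsetPn; exists i; first by rewrite inE nFiW Di eqxx.
  rewrite inE nFiW /= Ci; apply: contra nFiW => /eqP FT.
  by have := TW i; rewrite -FT subUset => /andP[].
- exact: refine_by_tom.
- by move=> k; rewrite D'E; case: ifP; [right | left].
Qed.

(** Raising the prices of the goods outside [W] until something new happens.  The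
    limit point to aim at comes from the covering of the face of [W]. *)
Lemma merge W F : covers W -> F \in M ->
    (forall i, ~~ (F i \subset W) -> [disjoint F i & W]) ->
    (exists i, ~~ (F i \subset W)) ->
  exists C, [/\ C \in M, forall i, F i \subset C i,
    forall i, C i \subset F i :|: W
    & exists i, ~~ (F i \subset W) /\ ~~ [disjoint C i & W]].
Proof.
move=> covW FM FdW exF; have [T [TM TW TF]] := face_extension covW FM.
have [C [CM CE [i [nFW Ci]]]] := merge_step FM FdW TM TW TF exF.
exists C; split=> // [k|k|].
- by case: (CE k) => [|[_]] ->; rewrite ?subsetUl.
- by case: (CE k) => [|[_]] ->; rewrite ?subsetUl ?setUS.
exists i; split=> //; have [j jT] := type_mem tomM i TM.
by apply/pred0Pn; exists j; rewrite /= Ci inE jT orbT (subsetP (TW i)).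
Qed.

(** A combinatorial ascending auction.  Among the types inside [W], take one
    whose largest excess is as small as possible, and then with as few pairs of
    a maximizing set and a row inside it as possible.  If the largest excess were
    positive, raise the prices of a smallest maximizing set [S]: refine
    away from [S], then merge with the goods of [W] outside [S].  That merging
    step needs the covering of the face spanned by [W :\: S], which is available
    by induction.  By uncrossing, the largest excess does not increase, and any
    set where the new type still attains it is a maximizing set of the old type
    containing [S].  So no pair of a maximizing set and a row is gained, while
    [S] loses the row that acquired goods outside it, contradicting
    minimality.  Hence no excess is positive, and Gale's theorem applies. *)
Lemma tom_covers W : W != set0 -> covers W.
Proof.
have [N] := ubnP #|W|; elim: N W => // N IHN W lt_WN /set0Pn[w wW] x y.
move=> x_ge0 y_ge0 eq_xy y_W.
pose inW A := (A \in M) && [forall i, A i \subset W].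
have inW0 : inW [ffun=> [set w]].
  rewrite /inW (tom_boundary tomM) /=; apply/forallP=> i.
  by rewrite ffunE sub1set.
pose top A := [arg max_(S > set0 : {set 'I_d}) excess x y A S]%O.
have le_top A S : excess x y A S <= excess x y A (top A).
  by rewrite /top; case: (arg_maxP (fun S => excess x y A S)) => // T _ /(_ S isT).
case: (arg_minP (fun A => excess x y A (top A)) inW0) => A0 A0W A0_min.
set mu := excess x y A0 (top A0) in A0_min.
have [mu_le0|mu_gt0] := lerP mu 0.
  have /andP[A0M /forallP A0subW] := A0W.
  exists A0; split=> //; apply: gale => // S; exact: le_trans (le_top A0 S) mu_le0.
pose opt A := inW A && [forall S, excess x y A S <= mu].
have optA0 : opt A0 by rewrite /opt A0W; apply/forallP=> S; exact: le_top.
pose tight A :=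
  [set p : {set 'I_d} * 'I_n | (excess x y A p.1 == mu) && (A p.2 \subset p.1)].
case: (arg_minnP (fun A => #|tight A|) optA0) => A optA A_min.
have /andP[AW /forallP le_mu] := optA.
have /andP[AM /forallP AsubW] := AW.
have top_mu : excess x y A (top A) == mu by rewrite eq_le le_mu A0_min.
case: (arg_minnP (fun S => #|S|) (P := fun S => excess x y A S == mu) top_mu).
move=> S /eqP S_mu S_min.
have [i0 AS0] : exists i, A i \subset S.
  apply/existsP; apply: contraLR mu_gt0 => /existsPn nAS.
  rewrite -leNgt -S_mu /excess big_pred0 => [|i]; last exact/negbTE.
  by rewrite sub0r oppr_le0 sumr_ge0.
have [j0 jA0] := type_mem tomM i0 AM.
have ltW' : (#|W :\: S| < #|W|)%N.
  apply: proper_card; rewrite properE subsetDl /=; apply/subsetPn; exists j0.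
    exact: (subsetP (AsubW i0)).
  by rewrite inE (subsetP AS0).
have W'_neq0 : W :\: S != set0.
  rewrite setD_eq0; apply: contraL mu_gt0 => WS.
  have subS j : j \notin S -> y j = 0.
    by move=> njS; apply: y_W; apply: contra njS; apply: (subsetP WS).
  rewrite -S_mu /excess -leNgt subr_le0.
  rewrite (eq_bigl xpredT) => [|i]; last exact: subset_trans (AsubW i) WS.
  by rewrite eq_xy (bigID (mem S)) /= [X in _ + X]big1 ?addr0.
(* F is A after a slight raise of the prices of S *)
pose F := refine_by (fun k => k \notin S) A.
have FS i : A i \subset S -> F i = A i.
  by move=> AS; apply: refine_by_id => j k /(subsetP AS) -> /(subsetP AS) ->.
have FD i : ~~ (A i \subset S) -> F i = A i :\: S.
  case/subsetPn=> j jA jS; apply/setP=> k; apply/in_refine_by/idP; rewrite inE.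
    by case=> -> /(_ j jA); rewrite jS andbT; case: (k \in S).
  by case/andP=> kS kA; split=> // l _; rewrite kS; case: (l \in S).
have FM : F \in M by exact: refine_by_tom.
have FsubA i : F i \subset A i by apply/subsetP=> k /in_refine_by[].
have FW' i : (F i \subset W :\: S) = ~~ (A i \subset S).
  have [AS|nAS] := boolP (A i \subset S).
    have [j jA] := type_mem tomM i AM; apply/subsetPn; exists j.
      by rewrite FS.
    by rewrite inE (subsetP AS).
  by rewrite FD // setSD.
have covW' : covers (W :\: S) by apply: IHN => //; apply: leq_trans ltW' _.
have [i|| C [CM FC CFW [i [nFi CiW']]]] := merge covW' FM.
- rewrite FW' negbK => AS; rewrite FS // disjoint_sym disjoints_subset.
  apply/subsetP=> k; rewrite !inE => /andP[kS _].
  by apply: contra kS; apply: (subsetP AS).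
- by exists i0; rewrite FW' AS0.
have CsubW k : C k \subset W.
  apply: subset_trans (CFW k) _; rewrite subUset subsetDl andbT.
  exact: subset_trans (FsubA k) (AsubW k).
have CS k : A k \subset S -> A k \subset C k by move=> AS; rewrite -(FS k AS).
have CD k : A k :\: S \subset C k.
  have [AS|nAS] := boolP (A k \subset S); last by rewrite -FD.
  by rewrite (eqP (_ : A k :\: S == set0)) ?sub0set // setD_eq0.
have AiS : A i \subset S by rewrite FW' negbK in nFi.
have nCiS : ~~ (C i \subset S).
  case/pred0Pn: CiW' => k /andP[/= kC]; rewrite inE => /andP[kS _].
  by apply/subsetPn; exists k.
have uncross (T : {set 'I_d}) := @excess_uncross R n d x y A C S T x_ge0 CS CD.
have optC : opt C.
  rewrite /opt /inW CM /=; apply/andP; split; first exact/forallP.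
  apply/forallP=> T; have := uncross T; have := le_mu (T :&: S).
  by have := le_mu (T :|: S); rewrite S_mu; lra.
have := A_min C optC; rewrite leqNgt => /negP[]; apply: proper_card.
rewrite properE; apply/andP; split; last first.
  apply/subsetPn; exists (S, i); rewrite inE /= ?S_mu ?eqxx //.
  by rewrite (negPf nCiS) andbF.
apply/subsetP=> -[T k]; rewrite !inE /= => /andP[/eqP T_mu CT].
have [cap_mu cup_mu] : excess x y A (T :&: S) == mu /\ excess x y A (T :|: S) == mu.
  have := uncross T; have := le_mu (T :&: S); have := le_mu (T :|: S).
  by rewrite S_mu T_mu => ? ? ?; split; apply/eqP; lra.
(* the intersection is maximizing, and S is a smallest maximizing set *)
have ST : S \subset T.
  have := S_min _ cap_mu => le_S.
  have /eqP <- : T :&: S == S by rewrite eqEcard subsetIr.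
  exact: subsetIl.
have TE : T :|: S = T by apply/setUidPl.
rewrite TE in cup_mu; rewrite cup_mu /= -TE setUC -subDset.
exact: subset_trans (CD k) CT.
Qed.

(** A type containing the given one with as many edges as possible is a vertex:
    otherwise merging across one of its connected components would add edges. *)
Lemma extend_to_vertex A : (0 < n)%N -> A \in M ->
  exists B, is_vertex M B /\ forall i, A i \subset B i.
Proof.
move=> n_gt0 AM; pose P B := (B \in M) && [forall i, A i \subset B i].
have PA : P A by rewrite /P AM; apply/forallP=> i.
case: (arg_maxnP (fun B => \sum_i #|B i|)%N PA) => B /andP[BM /forallP AB] B_max.
exists B; split=> //; split=> // i j.
have Bsym : connect_sym (type_graph B).
  apply: sym_connect_sym => a b; rewrite /type_graph.
  by apply: eq_existsb => k; rewrite andbC.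
apply/negPn/negP => nij.
have noC W : W != set0 -> (exists i, ~~ (B i \subset W)) ->
    (forall i, ~~ (B i \subset W) -> [disjoint B i & W]) -> False.
  move=> W_neq0 exB BdW.
  have [C [CM BC _ [k [nBW CkW]]]] := merge (tom_covers W_neq0) BM BdW exB.
  have PC : P C by rewrite /P CM; apply/forallP=> l; apply: subset_trans (BC l).
  have := B_max C PC; rewrite /= leqNgt => /negP[].
  rewrite (bigD1 k) //= [X in (_ < X)%N](bigD1 k) //= -addSn leq_add //.
    apply: proper_card; rewrite properE BC; apply: contra CkW => CB.
    exact: disjointWl (BdW k nBW).
  by apply: leq_sum => l _; apply: subset_leq_card.
pose W := [set k | connect (type_graph B) j k].
have BW k : B k \subset W \/ [disjoint B k & W].
  have [|/pred0Pn[a /andP[/= aB]]] := boolP [disjoint B k & W]; first by right.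
  rewrite inE => ja; left; apply/subsetP=> b bB; rewrite inE.
  by apply: connect_trans ja (connect1 _); apply/existsP; exists k; rewrite aB.
have [/existsP[k nBkW]|/existsPn allB] := boolP [exists k, ~~ (B k \subset W)].
  apply: (noC W) => [||l]; first by apply/set0Pn; exists j; rewrite inE.
    by exists k.
  by case: (BW l) => [->|].
(* all rows lie in the component of j: merge from its complement instead *)
apply: (noC (~: W)) => [||l _].
- by apply/set0Pn; exists i; rewrite !inE Bsym.
- have [k kB] := type_mem tomM (Ordinal n_gt0) BM; exists (Ordinal n_gt0).
  have /negPn/subsetP/(_ k kB) kW := allB (Ordinal n_gt0).
  by apply/subsetPn; exists k; rewrite // !inE negbK -in_set.
- by rewrite disjoints_subset setCK; apply/negPn/allB.
Qed.

End Covering.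

From mathcomp Require Import boolp classical_sets interval_inference reals convex.

Local Open Scope classical_set_scope.

(** * Cells, their faces and their dimension *)

Section Geometry.
Local Open Scope ring_scope.
Variable R : realType.

Lemma convex_setP m (X : set 'rV[R]_m) : @convex_set R 'rV[R]_m X <->
  forall x y t, X x -> X y -> 0 <= t -> t <= 1 -> X (t *: x + (1 - t) *: y).
Proof.
split=> [cX x y t Xx Xy t0 t1|cX x y t /set_mem Xx /set_mem Xy].
  by have := cX x y (Itv01 t0 t1) (mem_set Xx) (mem_set Xy); move/set_mem.
by apply/mem_set/cX.
Qed.

(** Induction on the number of nonzero weights: split off one term and rescale
    the others. *)
Lemma convex_sum m (I : finType) (X : set 'rV[R]_m) (w : I -> R) (g : I -> 'rV[R]_m) :
    @convex_set R 'rV[R]_m X -> (forall i, 0 <= w i) -> \sum_i w i = 1 ->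
    (forall i, w i != 0 -> X (g i)) ->
  X (\sum_i w i *: g i).
Proof.
move/convex_setP=> cX.
have [N] := ubnP #|[set i | w i != 0]%SET|; elim: N w => // N IHN w lt_N w_ge0 w1 Xg.
have [i wi|w0] := pickP (fun i => w i != 0); last first.
  have /eqP := w1; rewrite big1 ?(eq_sym 0) ?oner_eq0 // => i _.
  by move/(_ i)/eqP: w0.
have sum_i : \sum_(k | k != i) w k = 1 - w i.
  by apply/eqP; rewrite -w1 [in X in _ == X](bigD1 i) //= addrAC subrr add0r.
have [wi1|wi1] := eqVneq (w i) 1.
  rewrite (bigD1 i) //= big1 ?addr0 ?wi1 ?scale1r; first exact: Xg.
  move=> k ki; move/eqP: sum_i; rewrite wi1 subrr psumr_eq0 // => /allP.
  by move=> /(_ k (mem_index_enum k)); rewrite ki => /eqP ->; rewrite scale0r.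
have le_wi : w i <= 1 by rewrite -subr_ge0 -sum_i sumr_ge0.
have lt_wi : 0 < 1 - w i by rewrite subr_gt0 lt_neqAle wi1.
pose w' k := if k == i then 0 else w k / (1 - w i).
have -> : \sum_k w k *: g k = w i *: g i + (1 - w i) *: \sum_k w' k *: g k.
  rewrite (bigD1 i) //= [in RHS](bigD1 i) //= {1}/w' eqxx scale0r add0r.
  rewrite scaler_sumr; congr (_ + _); apply: eq_bigr => k /negPf ki.
  by rewrite /w' ki scalerA mulrCA divff ?mulr1 // gt_eqF.
apply: cX; [exact: Xg | | by [] | by []].
apply: IHN.
- rewrite ltnS in lt_N; apply: leq_trans lt_N; apply: proper_card.
  rewrite properE; apply/andP; split; last first.
    by apply/fintype.subsetPn; exists i; rewrite inE ?wi // /w' eqxx eqxx.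
  apply/fintype.subsetP=> k; rewrite !inE /w'.
  case: (k =P i) => [_|_]; first by rewrite eqxx.
  by apply: contraNneq => ->; rewrite mul0r.
- by move=> k; rewrite /w'; case: eqP => // _; rewrite divr_ge0 // ltW.
- rewrite (bigD1 i) //= {1}/w' eqxx add0r.
  under eq_bigr => k /negPf ki do rewrite /w' ki.
  by rewrite -mulr_suml sum_i divff // gt_eqF.
- move=> k; rewrite /w'; case: (k =P i) => [_|_]; first by rewrite eqxx.
  by move=> wk; apply: Xg; apply: contraNneq wk => ->; rewrite mul0r.
Qed.

Lemma conv_hull_finite m (I : finType) (P : pred I) (g : I -> 'rV[R]_m) :
  conv_hull [set g i | i in [set i | P i]] =
  [set x | exists w : I -> R, [/\ forall i, 0 <= w i, forall i, ~~ P i -> w i = 0,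
     \sum_i w i = 1 & x = \sum_i w i *: g i]].
Proof.
apply/seteqP; split.
  apply: smallest_sub.
    apply/convex_setP => x y t [u [u0 uP u1 ->]] [v [v0 vP v1 ->]] t0 t1.
    have t1' : 0 <= 1 - t by rewrite subr_ge0.
    exists (fun i => t * u i + (1 - t) * v i); split.
    - by move=> i; rewrite addr_ge0 ?mulr_ge0.
    - by move=> i Pi; rewrite uP ?vP // !mulr0 addr0.
    - by rewrite big_split -!mulr_sumr u1 v1 /= !mulr1 addrC subrK.
    - rewrite !scaler_sumr -big_split; apply: eq_bigr => i _ /=.
      by rewrite !scalerA -scalerDl.
  move=> _ [i /= Pi <-]; exists (fun k => (k == i)%:R); split.
  - by move=> k; rewrite ler0n.
  - by move=> k; case: eqP => // -> /negP.
  - by rewrite (bigD1 i) //= eqxx big1 ?addr0 // => k /negPf ->.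
  - rewrite (bigD1 i) //= eqxx scale1r big1 ?addr0 // => k /negPf ->.
    by rewrite scale0r.
move=> _ [w [w0 wP w1 ->]] X [cX gX]; apply: convex_sum => // i wi.
by apply: gX; exists i => //=; apply/negPn/negP => /wP/eqP; apply/negP.
Qed.

Lemma std_simplexE k : std_simplex R k =
  [set x | (forall i, 0 <= x 0 i) /\ \sum_i x 0 i = 1].
Proof.
rewrite /std_simplex (_ : [set: 'I_k] = [set i | predT i]); last by apply/seteqP.
rewrite conv_hull_finite; apply/seteqP; split=> x.
  case=> w [w0 _ w1 ->].
  have wE i : (\sum_i0 w i0 *: delta_mx 0 i0 : 'rV_k) 0 i = w i.
    rewrite summxE (bigD1 i) //= !mxE !eqxx mulr1 big1 ?addr0 // => l /negPf li.
    by rewrite !mxE eq_sym li mulr0.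
  by split=> [i|]; rewrite ?wE //; under eq_bigr do rewrite wE.
by case=> x0 x1; exists (x 0); split=> //; exact: row_sum_delta.
Qed.

Variables (n d : nat).
Implicit Types A B : ntuple_sets n d.

Lemma prod_vertex_sum (w : 'I_n * 'I_d -> R) :
  \sum_p w p *: prod_vertex R p.1 p.2
    = row_mx (\row_i \sum_j w (i, j)) (\row_j \sum_i w (i, j)).
Proof.
under eq_bigr do rewrite /prod_vertex scale_row_mx.
have -> : \sum_p row_mx (w p *: delta_mx 0 p.1) (w p *: delta_mx 0 p.2)
  = row_mx (\sum_p w p *: delta_mx 0 p.1) (\sum_p w p *: delta_mx 0 p.2) :> 'rV[R]_(n + d).
  by elim/big_rec3: _ => [|p a b c _ ->]; rewrite ?row_mx0 ?add_row_mx.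
congr row_mx; apply/rowP=> k; rewrite summxE mxE.
  transitivity (\sum_p (w (p.1, p.2) *: delta_mx 0 p.1 : 'rV[R]_n) 0 k).
    by apply: eq_bigr => -[].
  rewrite -(pair_bigA _ (fun i j => (w (i, j) *: delta_mx 0 i : 'rV[R]_n) 0 k)) /=.
  rewrite (bigD1 k) //= [X in _ + X]big1 ?addr0 => [|i /negPf ik].
    by apply: eq_bigr => j _; rewrite !mxE !eqxx mulr1.
  by apply: big1 => j _; rewrite !mxE eq_sym ik mulr0.
transitivity (\sum_p (w (p.1, p.2) *: delta_mx 0 p.2 : 'rV[R]_d) 0 k).
  by apply: eq_bigr => -[].
rewrite -(pair_bigA _ (fun i j => (w (i, j) *: delta_mx 0 j : 'rV[R]_d) 0 k)) /=.
apply: eq_bigr => i _; rewrite (bigD1 k) //= !mxE !eqxx mulr1.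
by rewrite big1 ?addr0 // => j /negPf jk; rewrite !mxE eq_sym jk mulr0.
Qed.

Lemma cellP A (x : 'rV[R]_n) (y : 'rV[R]_d) :
  cell R A (row_mx x y) <->
  (exists m, transport A (x 0) (y 0) m) /\ \sum_i x 0 i = 1.
Proof.
rewrite /cell (_ : [set x | _] = [set prod_vertex R p.1 p.2
    | p in [set p : 'I_n * 'I_d | p.2 \in A p.1]]); last first.
  apply/seteqP; split=> [_ [i [j [jA ->]]]|_ [[i j] /= jA <-]]; last by exists i, j.
  by exists (i, j).
rewrite conv_hull_finite; split.
  case=> w [w0 wA w1]; rewrite prod_vertex_sum => /eq_row_mx[-> ->].
  split; last first.
    by under eq_bigr do rewrite mxE; rewrite pair_big -w1; apply: eq_bigr => -[].
  exists (fun i j => w (i, j)); split=> // [i j|i|j]; rewrite ?mxE //.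
  by move=> njA; exact: wA.
case=> -[m [m0 mA m_row m_col]] x1; exists (fun p => m p.1 p.2); split=> //.
- by move=> [i j] /mA.
- by rewrite -(pair_bigA _ (fun i j => m i j)) -x1 /=; apply: eq_bigr => i _.
- by rewrite prod_vertex_sum /=; congr row_mx; apply/rowP=> k; rewrite mxE.
Qed.

Lemma simplex_productP (x : 'rV[R]_n) (y : 'rV[R]_d) :
  simplex_product R n d (row_mx x y) <->
  [/\ forall i, 0 <= x 0 i, forall j, 0 <= y 0 j,
      \sum_i x 0 i = 1 & \sum_j y 0 j = 1].
Proof.
rewrite /simplex_product !std_simplexE; split.
  by case=> a [a0 a1] [b [b0 b1]] /eq_row_mx[<- <-].
by case=> x0 y0 x1 y1; exists x => //; exists y.
Qed.

(** The supporting hyperplane is the one that separates the two cells; it meets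
    the cell of [A] in the transports that only use edges of [B]. *)
Lemma cell_face A B : cg_acyclic A B -> is_face (cell R A `&` cell R B) (cell R A).
Proof.
case/acyclic_separation=> h [t sep].
exists (col_mx (\col_i - (t i)%:R) (\col_j (h j)%:R)), 0.
have value (x : 'rV[R]_n) (y : 'rV[R]_d) :
    (row_mx x y *m col_mx (\col_i - (t i)%:R) (\col_j (h j)%:R)) 0 0
    = \sum_j y 0 j * (h j)%:R - \sum_i x 0 i * (t i)%:R.
  rewrite mul_row_col !mxE addrC -sumrN; congr (_ + _).
    by apply: eq_bigr => j _; rewrite mxE.
  by apply: eq_bigr => i _; rewrite mxE mulrN.
split=> [v|].
  rewrite -[v]hsubmxK value => /cellP[[m mA] _].
  by rewrite subr_le0 (separated_le sep mA).
apply/seteqP; split=> v; rewrite -[v]hsubmxK => -[vA].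
  move=> vB; split=> //=; rewrite value; apply/eqP; rewrite eq_le.
  have [[m mA] _] := (cellP _ _ _).1 vA; have [[m' m'B] _] := (cellP _ _ _).1 vB.
  by rewrite subr_le0 subr_ge0 (separated_le sep mA) (separated_ge sep m'B).
rewrite /= value => /eqP; rewrite subr_eq0 => eq_val; split=> //.
have [[m mA] x1] := (cellP _ _ _).1 vA; apply/cellP; split=> //.
have m_B i j : m i j != 0 -> j \in B i.
  have := separated_le sep mA; case=> _; rewrite eq_val => /esym.
  by move/forallP/(_ i)/forallP/(_ j)/implyP.
have [m_ge0 _ m_row m_col] := mA.
exists m; split=> // i j njB; apply/eqP; apply: contraNT njB; exact: m_B.
Qed.

Definition sum_mx : 'M[R]_(n + d, 1 + 1) :=
  block_mx (const_mx 1) 0 0 (const_mx 1).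

(** The linear space parallel to the affine hull of the product of simplices. *)
Definition directions : {vspace 'rV[R]_(n + d)} := lker (linfun (mulmxr sum_mx)).

Lemma row_sum_mx (x : 'rV[R]_n) (y : 'rV[R]_d) :
  row_mx x y *m sum_mx = row_mx (\sum_i x 0 i)%:M (\sum_j y 0 j)%:M.
Proof.
have sumE k (z : 'rV[R]_k) : z *m const_mx 1 = (\sum_i z 0 i)%:M :> 'M_1.
  by apply/matrixP=> i j; rewrite !ord1 !mxE; apply: eq_bigr => l _; rewrite mxE mulr1.
by rewrite mul_row_block !mulmx0 addr0 add0r !sumE.
Qed.

Lemma mem_directions (x : 'rV[R]_n) (y : 'rV[R]_d) :
  (row_mx x y \in directions) = (\sum_i x 0 i == 0) && (\sum_j y 0 j == 0).
Proof.
rewrite memv_ker lfunE /= row_sum_mx -[X in _ == X](@row_mx0 _ 1 1 1).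
apply/eqP/andP => [/eq_row_mx[x0 y0]|[/eqP -> /eqP ->]]; last first.
  by rewrite raddf0.
by split; apply/eqP; [move/matrixP/(_ 0 0): x0 | move/matrixP/(_ 0 0): y0]; rewrite !mxE.
Qed.

Lemma dim_directions : (0 < n)%N -> (0 < d)%N -> \dim directions = (n + d - 2)%N.
Proof.
move=> n_gt0 d_gt0.
pose f := linfun (mulmxr sum_mx) : 'Hom('rV[R]_(n + d), 'rV[R]_(1 + 1)).
have f_onto : (f @: fullv)%VS = fullv.
  apply/eqP; rewrite eqEsubv subvf /=; apply/subvP=> w _.
  apply/memv_imgP; exists (row_mx (w 0 (lshift 1 0) *: delta_mx 0 (Ordinal n_gt0))
    (w 0 (rshift 1 0) *: delta_mx 0 (Ordinal d_gt0))); first exact: memvf.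
  have sumZ k (i : 'I_k) (c : R) : \sum_l (c *: delta_mx 0 i : 'rV[R]_k) 0 l = c.
    rewrite (bigD1 i) //= !mxE !eqxx mulr1 big1 ?addr0 // => l /negPf li.
    by rewrite !mxE li mulr0.
  rewrite lfunE /= row_sum_mx !sumZ -[LHS]hsubmxK.
  by congr row_mx; apply/matrixP=> i j; rewrite !ord1 !mxE eqxx.
have := limg_ker_dim f fullv; rewrite capfv f_onto !dimvf !dim_matrix.
by rewrite !mul1r => dim_sum; apply: (canRL (addnK 2)); exact: dim_sum.
Qed.

(** Two goods in one row differ by a vector [(0, f_j - f_k)]; by connectivity all
    such vectors are directions of the affine hull, and then so are all
    vectors [(e_i - e_k, 0)].  Together they span the directions of the ambient
    product. *)
Lemma affine_hull_cell A i0 j0 : (forall j k, connect (type_graph A) j k) ->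
    is_type A -> j0 \in A i0 ->
  affine_hull (cell R A) = affine_through (prod_vertex R i0 j0) directions.
Proof.
move=> A_conn A_type jA0; set p0 := prod_vertex R i0 j0.
have gen i j : j \in A i -> cell R A (prod_vertex R i j).
  by move=> jA; apply: sub_gen_smallest; exists i, j.
apply/seteqP; split.
  apply: smallest_sub; first by exists p0, directions.
  move=> v; rewrite -[v]hsubmxK => /cellP[[m [_ _ m_row m_col]] x1].
  rewrite /affine_through /= /p0 /prod_vertex opp_row_mx add_row_mx mem_directions.
  have sum_diff k (z : 'rV[R]_k) l : \sum_i (z - delta_mx 0 l) 0 i = \sum_i z 0 i - 1.
    under eq_bigr do rewrite !mxE /=.
    rewrite sumrB; congr (_ - _).
    by rewrite (bigD1 l) //= eqxx big1 ?addr0 // => i /negPf ->.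
  rewrite !sum_diff x1 subrr eqxx /= -x1 subr_eq0; apply/eqP.
  under eq_bigr do rewrite -m_col; rewrite exchange_big /=.
  by under eq_bigr do rewrite m_row.
move=> v vp0 X [[x1 [U ->]] cellX]; rewrite /affine_through /= in vp0 *.
rewrite -(subrK p0 v) -addrA memvD //; last exact: (cellX _ (gen _ _ jA0)).
move: vp0; rewrite -[v - p0]hsubmxK.
move: (lsubmx _) (rsubmx _) => x y; rewrite mem_directions => /andP[/eqP x0 /eqP y0].
have genU i j k l : j \in A i -> l \in A k -> prod_vertex R i j - prod_vertex R k l \in U.
  move=> /gen/cellX ijU /gen/cellX klU.
  by rewrite -(subrKA x1) -[x1 - _]opprB memvB.
have colU j k : row_mx 0 (delta_mx 0 j - delta_mx 0 k) \in U.
  have /connectP[p jp ->] := A_conn j k; elim: p j jp => [|l p IHp] j /=.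
    by rewrite subrr row_mx0 mem0v.
  case/andP=> /existsP[i /andP[jA lA]] /IHp U_lk.
  rewrite -(subrKA (delta_mx 0 l)) -[0]addr0 -add_row_mx memvD //.
  have := genU i j i l jA lA.
  by rewrite /prod_vertex opp_row_mx add_row_mx subrr.
have rowU i : row_mx (delta_mx 0 i - delta_mx 0 i0) 0 \in U.
  have /set0Pn[j jA] := forallP A_type i.
  have := memvB (genU i j i0 j0 jA jA0) (colU j j0).
  by rewrite /prod_vertex !opp_row_mx !add_row_mx subr0 subrr.
have deltaE k (z : 'rV[R]_k) l : \sum_i z 0 i = 0 ->
    z = \sum_i z 0 i *: (delta_mx 0 i - delta_mx 0 l).
  move=> z0; under eq_bigr do rewrite scalerBr.
  by rewrite sumrB -scaler_suml z0 scale0r subr0 -row_sum_delta.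
rewrite (deltaE _ x i0 x0) (deltaE _ y j0 y0) -[X in row_mx X _]addr0.
rewrite -[X in row_mx _ X]add0r -add_row_mx memvD //.
  have -> : row_mx (\sum_i x 0 i *: (delta_mx 0 i - delta_mx 0 i0)) 0
      = \sum_i x 0 i *: row_mx (delta_mx 0 i - delta_mx 0 i0) 0 :> 'rV[R]_(n + d).
    elim/big_rec2: _ => [|i _ z _ <-]; first by rewrite row_mx0.
    by rewrite scale_row_mx add_row_mx scaler0 addr0.
  by apply: memv_suml => i _; apply/memvZ/rowU.
have -> : row_mx 0 (\sum_j y 0 j *: (delta_mx 0 j - delta_mx 0 j0))
    = \sum_j y 0 j *: row_mx 0 (delta_mx 0 j - delta_mx 0 j0) :> 'rV[R]_(n + d).
  elim/big_rec2: _ => [|j _ z _ <-]; first by rewrite row_mx0.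
  by rewrite scale_row_mx add_row_mx scaler0 addr0.
by apply: memv_suml => j _; apply/memvZ/colU.
Qed.

End Geometry.

Theorem theorem6p2 (R : realType) (n d : nat) (n_gt0 : (0 < n)%N) (d_gt0 : (0 < d)%N)
    (M : {set ntuple_sets n d}) (tomM : tropical_oriented_matroid M) :
  is_subdivision [set cell R A | A in [set A | is_vertex M A]].
Proof.
split.
- move=> _ [A [AM A_conn] <-]; split.
    exists [set x | exists i j, j \in A i /\ x = prod_vertex R i j] => //.
    by move=> _ [i [j [_ ->]]]; exists i => //; exists j.
  have [j0 jA0] := type_mem tomM (Ordinal n_gt0) AM.
  exists (prod_vertex R (Ordinal n_gt0) j0), (directions R n d); split.
    exact: affine_hull_cell A_conn (tom_types tomM AM) jA0.
  exact: dim_directions.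
- apply/seteqP; split=> v; rewrite -[v]hsubmxK.
    move=> [_ [A _ <-] /cellP[[m [m_ge0 _ m_row m_col]] x1]].
    apply/simplex_productP; split=> // [i|j|].
    + by rewrite -m_row sumr_ge0.
    + by rewrite -m_col sumr_ge0.
    rewrite -x1; under eq_bigr do rewrite -m_col; rewrite exchange_big /=.
    by under eq_bigr do rewrite m_row.
  case/simplex_productP=> x_ge0 y_ge0 x1 y1.
  have setT_neq0 : [set: 'I_d]%SET != finset.set0.
    by apply/set0Pn; exists (Ordinal d_gt0); rewrite inE.
  have [|j|A [AM _ [m mA]]] := tom_covers tomM setT_neq0 x_ge0 y_ge0.
  + by rewrite x1 y1.
  + by rewrite inE.
  have [B [B_vertex AB]] := extend_to_vertex R tomM n_gt0 AM.
  exists (cell R B); first by exists B.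
  apply/cellP; split=> //; exists m.
  have [m_ge0 m_supp m_row m_col] := mA; split=> // i j njB; apply: m_supp.
  by apply: contra njB; apply: (fintype.subsetP (AB i)).
- move=> _ _ [A [AM _] <-] [B [BM _] <-]; split.
    exact: cell_face (tom_comparability tomM AM BM).
  rewrite setIC; exact: cell_face (tom_comparability tomM BM AM).
Qed.
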